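(* For every integer $n\ge 2$ and every $G\in\{C_3,C_4,S_3\}$, $f(n,G)\le 2^{n-2}$.
   Context: $[n]=\{1,\dots,n\}$ and $\mathcal{P}(n)$ is the set of all subsets of $[n]$. $C_k$ and $S_k$ denote the cycle and the star with $k$ edges, respectively. For a graph $G$, a hypergraph $H$ is called Berge-$G$ if there is a copy of $G$ with $V(G)\subseteq V(H)$ and a bijection $g:E(G)\to E(H)$ such that $e\subseteq g(e)$ for every $e\in E(G)$. A family of subsets of $[n]$ (viewed as a hypergraph with vertex set $[n]$) is $G$-free if it contains no subfamily that is a Berge-$G$ hypergraph. $f(n,G)$ denotes the smallest number of colors in a coloring (partition) of $\mathcal{P}(n)$ such that every color class is $G$-free. *)

(* Defs.v *)
From mathcomp Require Import all_boot.
Set Implicit Arguments.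
Unset Strict Implicit.
Unset Printing Implicit Defensive.

Record sgraph := SGraph {
  vertex : finType;
  adj : rel vertex;
  adj_sym : symmetric adj;
  adj_irrefl : irreflexive adj
}.

Definition edges (G : sgraph) : {set {set vertex G}} :=
  [set [set p.1; p.2] | p : vertex G * vertex G & adj p.1 p.2].

(* The cyclic order on 'I_k is given by [ordS]. This is the k-cycle only for
   k >= 3: a simple graph has no loops or double edges. *)
Definition cycle_adj k : rel 'I_k :=
  [rel i j | (i != j) && ((j == ordS i) || (i == ordS j))].

Lemma cycle_adj_sym k : symmetric (@cycle_adj k).
Proof. by move=> i j; rewrite /cycle_adj /= eq_sym orbC. Qed.

Lemma cycle_adj_irrefl k : irreflexive (@cycle_adj k).
Proof. by move=> i; rewrite /cycle_adj /= eqxx. Qed.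

Definition cycle_graph k : sgraph :=
  SGraph (@cycle_adj_sym k) (@cycle_adj_irrefl k).

(* k edges, hence k + 1 vertices, with centre [ord0]. *)
Definition star_adj k : rel 'I_k.+1 :=
  [rel i j | (i == ord0) != (j == ord0)].

Lemma star_adj_sym k : symmetric (@star_adj k).
Proof. by move=> i j; rewrite /star_adj /= eq_sym. Qed.

Lemma star_adj_irrefl k : irreflexive (@star_adj k).
Proof. by move=> i; rewrite /star_adj /= eqxx. Qed.

Definition star_graph k : sgraph :=
  SGraph (@star_adj_sym k) (@star_adj_irrefl k).

(* [phi] is the copy of G inside the vertex set W of H. Only the restriction
   of [g] to [edges G] matters; it is a bijection from [edges G] onto H. *)
Definition berge (W : finType) (G : sgraph) (H : {set {set W}}) : bool :=
  [exists phi : {ffun vertex G -> W}, injectiveb phi &&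
    [exists g : {ffun {set vertex G} -> {set W}},
      [&& dinjectiveb g (edges G), g @: edges G == H
        & [forall e in edges G, phi @: e \subset g e]]]].

Definition berge_free (W : finType) (G : sgraph) (F : {set {set W}}) : bool :=
  ~~ [exists H : {set {set W}}, (H \subset F) && berge G H].

(* [colorable n G k]: the power set of 'I_n has a coloring with (at most) k
   colors all of whose color classes are G-free. *)
Definition colorable (n : nat) (G : sgraph) (k : nat) : bool :=
  [exists c : {ffun {set 'I_n} -> 'I_k},
    [forall i, berge_free G [set A | c A == i]]].

(* The least k such that [colorable n G k]. Searching up to 2 ^ n loses
   nothing as soon as G has two edges (see [colorable_pow]); if G has at most
   one edge, there may be no valid coloring and the value defaults to 2 ^ n. *)
Definition f (n : nat) (G : sgraph) : nat :=
  [arg min_(k < (ord_max : 'I_(2 ^ n).+1) | colorable n G k) (k : nat)].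

Lemma colorable_pow n G : 1 < #|edges G| -> colorable n G (2 ^ n).
Proof.
move=> G2; have card2n : #|{set 'I_n}| = 2 ^ n by rewrite -cardsT -powersetT card_powerset cardsT card_ord.
apply/existsP.
exists [ffun A => cast_ord card2n (enum_rank A)].
apply/forallP => i; apply/existsPn => H; apply/negP => /andP[/subsetP sHi].
case/existsP=> phi /andP[_ /existsP[g /and3P[/dinjectiveP ginj /eqP defH _]]].
move: G2; rewrite -(card_in_imset ginj) defH => /card_gt1P[A [B [AH BH]]].
case/eqP; apply: enum_rank_inj; apply: (@cast_ord_inj _ _ card2n).
by move: (sHi _ AH) (sHi _ BH); rewrite !inE !ffunE => /eqP-> /eqP->.
Qed.

Lemma f_colorable n G : 1 < #|edges G| -> colorable n G (f n G).
Proof. by move=> G2; rewrite /f; case: arg_minnP => //; exact: colorable_pow. Qed.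

Lemma f_min n G k : 1 < #|edges G| -> colorable n G k -> f n G <= k.
Proof.
move=> G2 kP; rewrite /f; case: arg_minnP => [|j _ jmin].
  exact: colorable_pow.
case: (ltnP k (2 ^ n).+1) => [k_lt|lt_k]; first exact: (jmin (Ordinal k_lt)).
by apply: leq_trans (ltnW lt_k); rewrite -ltnS ltn_ord.
Qed.

(* Main.v *)
Require Import Defs.
From mathcomp Require Import all_boot.

Set Implicit Arguments.
Unset Strict Implicit.
Unset Printing Implicit Defensive.

(** Fix two points [a != z] of the ground set and group the subsets into blocks
    [{A, a |: A, ~: A, ~: (a |: A)}], where [A] contains neither [a] nor [z].
    There are [2 ^ (n - 2)] blocks, one for each such [A], and they are the
    color classes.  Inside a block, [A] is disjoint from [~: A] and from
    [~: (a |: A)], and [a |: A] is disjoint from [~: (a |: A)], so the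
    intersection graph of the block is contained in the path
    [A -- a |: A -- ~: A -- ~: (a |: A)].

    A Berge copy of [G] inside a block embeds the line graph of [G] into the
    intersection graph of the block, since edges with a common vertex are sent
    to sets with a common point.  In [C_3], [C_4] and [S_3] every edge meets
    two other edges, so the line graph has minimum degree at least 2, whereas
    every nonempty subgraph of a path has a vertex of degree at most 1
    ([key_class_berge_free]).  The same argument applies to all cycles and
    stars with at least three edges ([cycle_graph_branching],
    [star_graph_branching]). *)

(** * Blocks of four sets whose intersection graph lies in a path *)

Section Blocks.

Variables (W : finType) (a z : W).
Hypothesis a_neq_z : a != z.

(** The set [A] that indexes the block of [X]; two sets are in the same block
    exactly when they have the same key. *)
Definition key (X : {set W}) : {set W} :=
  (if z \in X then ~: X else X) :\ a.

Lemma key_sub X : key X \subset ~: [set a; z].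
Proof.
apply/subsetP => w; rewrite /key !inE; case: ifP => zX; rewrite ?inE;
by case: (eqVneq w a) => //= _; case: eqP => // ->; rewrite zX.
Qed.

Lemma key_eq_mem X Y w : key X = key Y -> w != a ->
  (w \in X) (+) (z \in X) = (w \in Y) (+) (z \in Y).
Proof.
move=> /setP/(_ w) + wa; rewrite /key !inE wa /=.
by do 2 case: ifP => _; rewrite ?inE ?addbT ?addbF.
Qed.

Lemma key_eq_inj X Y : key X = key Y ->
  (a \in X) = (a \in Y) -> (z \in X) = (z \in Y) -> X = Y.
Proof.
move=> eqK eqa eqz; apply/setP => w.
have [-> //|wa] := eqVneq w a.
by have := key_eq_mem eqK wa; rewrite eqz => /addIb.
Qed.

(** The path: each side of the test on [z] is a pair [A, a |: A] or
    [~: (a |: A), ~: A], and the only link between the two sides joins the two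
    sets that contain [a]. *)
Definition linked (X Y : {set W}) : bool :=
  if (z \in X) == (z \in Y) then (a \in X) != (a \in Y)
  else (a \in X) && (a \in Y).

(** Sets of a block on different sides of [z] are complementary away from [a],
    so that [a] is their only possible common point. *)
Lemma meet_linked X Y w : key X = key Y -> X != Y ->
  w \in X -> w \in Y -> linked X Y.
Proof.
move=> eqK XY wX wY; rewrite /linked; case: eqP => [eqz|neqz].
  by apply: contraNneq XY => eqa; apply/eqP/key_eq_inj.
have [<-|wa] := eqVneq w a; first by rewrite wX wY.
by have := key_eq_mem eqK wa; rewrite wX wY => /addbI.
Qed.

(** A set without [a] is an end of the path; once the ends are discarded, the
    sets with [a] have at most one neighbour too. *)
Lemma linked_unique X Y1 Y2 : key Y1 = key Y2 ->
  linked X Y1 -> linked X Y2 ->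
  (a \in X -> (a \in Y1) && (a \in Y2)) -> Y1 = Y2.
Proof.
move=> eqK; rewrite /linked => l1 l2 aXY; apply: key_eq_inj => //;
by move: l1 l2 aXY; do 3 case: (a \in _); do 3 case: (z \in _) => //=;
   move=> // _ _ /(_ isT).
Qed.

(** Minimum degree at least 2 in the line graph of [G]. *)
Definition branching (G : sgraph) : Prop :=
  forall e, e \in edges G -> exists e1 e2,
    [/\ e1 \in edges G /\ e2 \in edges G,
        [/\ e != e1, e != e2 & e1 != e2],
        e :&: e1 != set0 & e :&: e2 != set0].

Lemma key_class_berge_free (G : sgraph) (F : {set {set W}}) :
    edges G != set0 -> branching G -> {in F &, forall X Y, key X = key Y} ->
  berge_free G F.
Proof.
move=> /set0Pn[e0 e0G] brG eqK; apply/existsPn => H; apply/negP.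
move=> /andP[/subsetP HF /existsP[phi /andP[_ /existsP[g]]]].
move=> /and3P[/dinjectiveP g_inj /eqP defH /forall_inP phi_g].
have gF e : e \in edges G -> g e \in F.
  by move=> eG; apply: HF; rewrite -defH imset_f.
have g_linked e e' : e \in edges G -> e' \in edges G -> e != e' ->
    e :&: e' != set0 -> linked (g e) (g e').
  move=> eG eG' ee' /set0Pn[v /setIP[ve ve']].
  apply: (@meet_linked _ _ (phi v)); first by apply: eqK; apply: gF.
  - by apply: contra ee' => /eqP/g_inj->.
  - by apply: (subsetP (phi_g _ eG)); apply: imset_f.
  - by apply: (subsetP (phi_g _ eG')); apply: imset_f.
(* Used twice: first for an image set without [a], where the premise is void,
   then for any image set once all of them are known to contain [a]. *)
have two_neighbours e : e \in edges G ->
    (a \in g e -> {in edges G, forall e', a \in g e'}) -> False.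
  move=> eG age; have [e1 [e2 [[e1G e2G] [ee1 ee2 e12] m1 m2]]] := brG e eG.
  case/eqP: e12; apply: g_inj => //; apply: (@linked_unique (g e)).
  - by apply: eqK; apply: gF.
  - exact: g_linked.
  - exact: g_linked.
  - by move=> /age ag; rewrite !ag.
have all_a : {in edges G, forall e, a \in g e}.
  move=> e eG; apply/negPn/negP => aNe.
  by apply: (two_neighbours e eG) => /(negP aNe).
exact: (two_neighbours e0).
Qed.

End Blocks.

(** * The number of blocks *)

Lemma colorable_of_key (n : nat) (G : sgraph) (T : finType) (K : {set T})
    (h : {set 'I_n} -> T) :
    (forall X, h X \in K) -> (forall t, berge_free G [set X | h X == t]) ->
  colorable n G #|K|.
Proof.
move=> hK hfree; apply/existsP.
exists [ffun X => enum_rank_in (hK set0) (h X)]; apply/forallP => i.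
suff -> : [set X | [ffun X => enum_rank_in (hK set0) (h X)] X == i]
        = [set X | h X == enum_val i] by [].
apply/setP => X; rewrite !inE ffunE; apply/eqP/eqP => [<-|->].
  by rewrite enum_rankK_in.
by rewrite enum_valK_in.
Qed.

Lemma branching_card_edges (G : sgraph) :
  edges G != set0 -> branching G -> 1 < #|edges G|.
Proof.
move=> /set0Pn[e eG] /(_ e eG)[e1 [e2 [[e1G _] [ee1 _ _] _ _]]].
by apply/card_gt1P; exists e, e1.
Qed.

Lemma f_branching (n : nat) (G : sgraph) :
  2 <= n -> edges G != set0 -> branching G -> f n G <= 2 ^ (n - 2).
Proof.
case: n => [|[|n]] // _ G0 brG.
apply: f_min; first exact: branching_card_edges.
have az : (ord0 : 'I_n.+2) != ord_max by [].
have <- : #|powerset (~: [set (ord0 : 'I_n.+2); ord_max])| = 2 ^ (n.+2 - 2).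
  by rewrite card_powerset cardsCs setCK cards2 az card_ord.
apply: (colorable_of_key (h := key ord0 ord_max)) => [X|t].
  by rewrite powersetE key_sub.
apply: (key_class_berge_free (a := ord0) (z := ord_max)) => // X Y.
by rewrite !inE => /eqP-> /eqP->.
Qed.

(** * Cycles and stars *)

Lemma adj_edge (G : sgraph) (u v : vertex G) :
  adj u v -> [set u; v] \in edges G.
Proof. by move=> uv; apply/imsetP; exists (u, v); rewrite ?inE. Qed.

Lemma edgeP (G : sgraph) (e : {set vertex G}) :
  e \in edges G -> exists u v : vertex G, adj u v /\ e = [set u; v].
Proof. by case/imsetP => -[u v]; rewrite inE /= => uv ->; exists u, v. Qed.

Lemma val_ordS k (i : 'I_k) : val (ordS i) = if i.+1 == k then 0 else i.+1.
Proof.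
rewrite /=; case: eqP => [->|/eqP ik]; first by rewrite modnn.
by rewrite modn_small // ltn_neqAle ik ltn_ord.
Qed.

Lemma ordS_neq k (i : 'I_k) : 1 < k -> ordS i != i.
Proof.
rewrite -val_eqE val_ordS; case: i => m /= _.
by case: (m.+1 =P k) => [<-|_ _]; [case: m | rewrite gtn_eqF].
Qed.

Lemma ordSS_neq k (i : 'I_k) : 2 < k -> ordS (ordS i) != i.
Proof.
rewrite -val_eqE 2!val_ordS; case: i => m /= _.
case: (m.+1 =P k) => [<-|_]; first by case: m => [|[]].
by case: (m.+2 =P k) => [<-|_ _]; [case: m | rewrite gtn_eqF // ltnW].
Qed.

Lemma cycle_edge k (i : 'I_k) : 1 < k ->
  [set i; ordS i] \in edges (cycle_graph k).
Proof. by move=> k1; apply: adj_edge; rewrite /= /cycle_adj /= eq_sym ordS_neq // eqxx. Qed.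

Lemma cycle_edgeP k (e : {set 'I_k}) :
  e \in edges (cycle_graph k) -> exists i, e = [set i; ordS i].
Proof.
case/edgeP => i [j [/andP[_ /orP[]/eqP->] ->]]; first by exists i.
by exists j; rewrite setUC.
Qed.

Lemma cycle_edges_neq0 k : 2 < k -> edges (cycle_graph k) != set0.
Proof.
case: k => // k k2; apply/set0Pn.
by exists [set ord0; ordS ord0]; apply/cycle_edge/ltnW.
Qed.

(** Consecutive edges differ because a cycle with at least three vertices does
    not return after two steps. For the same reason the first endpoint of an edge
    tells its two neighbours apart, which also holds in the triangle, where
    these neighbours meet. *)
Lemma cycle_graph_branching k : 2 < k -> branching (cycle_graph k).
Proof.
move=> k2 e /cycle_edgeP[i ->]; set p := ord_pred i.
have k1 := ltnW k2; have Sp : ordS p = i by exact: ord_predK.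
have consecutive (j : 'I_k) : [set j; ordS j] != [set ordS j; ordS (ordS j)].
  apply/eqP => /setP/(_ j); rewrite !inE eqxx /= eq_sym (negPf (ordS_neq _ k1)).
  by rewrite eq_sym (negPf (ordSS_neq _ k2)).
exists [set p; ordS p], [set ordS i; ordS (ordS i)]; split.
- by split; apply: cycle_edge.
- split=> //; first by have := consecutive p; rewrite Sp eq_sym.
  apply/eqP => /setP/(_ i); rewrite Sp !inE eqxx orbT.
  rewrite eq_sym (negPf (ordS_neq _ k1)).
  by rewrite eq_sym (negPf (ordSS_neq _ k2)).
- by apply/set0Pn; exists i; rewrite Sp !inE eqxx orbT.
- by apply/set0Pn; exists (ordS i); rewrite !inE eqxx orbT.
Qed.

Lemma star_edge k (i : 'I_k.+1) : i != ord0 ->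
  [set ord0; i] \in edges (star_graph k).
Proof. by move=> i0; apply: adj_edge; rewrite /= /star_adj /= eqxx (negPf i0). Qed.

Lemma star_edgeP k (e : {set 'I_k.+1}) : e \in edges (star_graph k) ->
  exists2 i, i != ord0 & e = [set ord0; i].
Proof.
case/edgeP => i [j []]; rewrite /= /star_adj /=; case: (eqVneq i ord0) => [->|i0]; last first.
  by case: (eqVneq j ord0) => // -> _ ->; exists i; rewrite // setUC.
by case: (eqVneq j ord0) => // j0 _ ->; exists j.
Qed.

Lemma star_edges_neq0 k : 0 < k -> edges (star_graph k) != set0.
Proof.
case: k => // k _; apply/set0Pn.
by exists [set ord0; ord_max]; apply: star_edge.
Qed.

(** All edges share the centre, and at least two leaves lie outside any given
    edge. *)
Lemma star_graph_branching k : 2 < k -> branching (star_graph k).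
Proof.
move=> k2 e /star_edgeP[i i0 ->].
have /card_gt1P[j [l [jC lC jl]]] : 1 < #|~: [set ord0; i]|.
  by rewrite cardsCs setCK card_ord cards2 eq_sym i0 /= ltn_subRL.
move: jC lC; rewrite !inE !negb_or => /andP[j0 ji] /andP[l0 li].
have star_inj (u v : 'I_k.+1) : u != ord0 -> u != v ->
    [set ord0; u] != [set ord0; v].
  move=> u0 uv; apply/eqP => /setP/(_ u).
  by rewrite !inE eqxx orbT (negPf u0) (negPf uv).
exists [set ord0; j], [set ord0; l]; split.
- by split; apply: star_edge.
- by rewrite !star_inj // eq_sym.
- by apply/set0Pn; exists ord0; rewrite !inE eqxx.
- by apply/set0Pn; exists ord0; rewrite !inE eqxx.
Qed.

Theorem proposition1 (n : nat) (hn : 2 <= n) (G : sgraph)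
  (hG : G = cycle_graph 3 \/ G = cycle_graph 4 \/ G = star_graph 3) :
  f n G <= 2 ^ (n - 2).
Proof.
case: hG => [->|[->|->]]; apply: f_branching => //.
- exact: cycle_edges_neq0.
- exact: cycle_graph_branching.
- exact: cycle_edges_neq0.
- exact: cycle_graph_branching.
- exact: star_edges_neq0.
- exact: star_graph_branching.
Qed.
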